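(* Let $\Gamma=(G,\sigma)$ be a connected signed graph with $G=(V,E)$, $|V|=n$, and $\sigma\equiv-1$. For each $p>1$ let $f^{(p)}\in\mathcal S_p$ be an eigenfunction of $\Delta_p^\sigma$ with eigenvalue $\lambda_n^{(p)}$. Then for every $i\in V$ the limit $\lim_{p\to\infty}|f^{(p)}(i)|^{p/2}$ exists, and the function $f(i):=\lim_{p\to\infty}|f^{(p)}(i)|^{p/2}$ is an eigenfunction of $A^\mu_{-\Gamma}$ corresponding to the eigenvalue $\lambda_n(A^\mu_{-\Gamma})$.
   Context: $G=(V,E)$ is a finite undirected graph without self-loops, $V=\{1,\dots,n\}$. A signed graph $\Gamma=(G,\sigma)$ has signature $\sigma:E\to\{\pm1\}$, edge weight $w:E\to(0,\infty)$, vertex measure $\mu:V\to(0,\infty)$, potential $\kappa:V\to\mathbb R$. With $\Psi_p(t)=|t|^{p-2}t$ ($\Psi_p(0)=0$), the $p$-Laplacian is $\Delta_p^\sigma f(i)=\sum_{j\sim i}w_{ij}\Psi_p(f(i)-\sigma_{ij}f(j))+\kappa_i\Psi_p(f(i))$; a nonzero $f$ is an eigenfunction with eigenvalue $\lambda$ if $\Delta_p^\sigma f(i)=\lambda\mu_i\Psi_p(f(i))$ for all $i$. $\mathcal R_p^\sigma(f)=\frac{\sum_{\{i,j\}\in E}w_{ij}|f(i)-\sigma_{ij}f(j)|^p+\sum_i\kappa_i|f(i)|^p}{\sum_i\mu_i|f(i)|^p}$; $\mathcal S_p=\{f:\sum_i\mu_i|f(i)|^p=1\}$; Krasnoselskii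 genus $\gamma(B)$ of closed symmetric $B\subset\mathbb R^n\setminus\{0\}$: least $k$ with an odd continuous map $B\to\mathbb R^k\setminus\{0\}$; $\mathcal F_k(\mathcal S_p)$ = closed symmetric $B\subset\mathcal S_p$ with $\gamma(B)\ge k$; variational eigenvalues $\lambda_k^{(p)}=\min_{B\in\mathcal F_k(\mathcal S_p)}\max_{f\in B}\mathcal R_p^\sigma(f)$ (in particular $\lambda_n^{(p)}=\max_{f\in\mathcal S_p}\mathcal R_p^\sigma(f)$). $-\Gamma=(G,-\sigma)$; $A_{\Gamma}$ has entries $\sigma_{ij}w_{ij}$ for $i\sim j$, $0$ otherwise; $A^\mu_\Gamma=\mathrm{diag}(\mu)^{-1}A_\Gamma$, with eigenvalues $\lambda_1\le\dots\le\lambda_n$. *)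

(* Defs.v *)
From HB Require Import structures.
From mathcomp Require Import all_boot all_order all_algebra.
From mathcomp Require Import all_classical all_reals all_analysis.
Set Implicit Arguments. Unset Strict Implicit. Unset Printing Implicit Defensive.
Import Order.TTheory GRing.Theory Num.Theory.
Local Open Scope ring_scope.
Local Open Scope classical_set_scope.

Section Defs.
Variable R : realType.
Variable n : nat.

Definition simple_graph (e : rel 'I_n) : Prop :=
  (forall i j, e i j = e j i) /\ (forall i, ~~ e i i).

Definition signed_weighted_graph (e : rel 'I_n) (sigma w : 'I_n -> 'I_n -> R)
  (mu : 'I_n -> R) : Prop :=
  simple_graph e /\
  (forall i j, e i j -> sigma i j = sigma j i /\ (sigma i j = 1 \/ sigma i j = -1)) /\
  (forall i j, e i j -> w i j = w j i /\ 0 < w i j) /\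
  (forall i, 0 < mu i).

Definition connected_graph (e : rel 'I_n) : Prop := forall i j, connect e i j.

Definition Psi (p t : R) : R := if t == 0 then 0 else (`|t| `^ (p - 2)) * t.

Definition pLap (e : rel 'I_n) (sigma w : 'I_n -> 'I_n -> R) (kappa : 'I_n -> R)
  (p : R) (f : 'I_n -> R) (i : 'I_n) : R :=
  \sum_(j | e i j) w i j * Psi p (f i - sigma i j * f j) + kappa i * Psi p (f i).

Definition is_p_eigenfunction (e : rel 'I_n) (sigma w : 'I_n -> 'I_n -> R)
  (mu kappa : 'I_n -> R) (p : R) (f : 'I_n -> R) (lam : R) : Prop :=
  (exists i, f i != 0) /\
  (forall i, pLap e sigma w kappa p f i = lam * mu i * Psi p (f i)).

(* Rayleigh quotient; each edge {i,j} counted once (i < j). *)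
Definition rayleigh (e : rel 'I_n) (sigma w : 'I_n -> 'I_n -> R)
  (mu kappa : 'I_n -> R) (p : R) (f : 'I_n -> R) : R :=
  (\sum_(i : 'I_n) \sum_(j : 'I_n | ((i < j)%N && e i j))
      w i j * (`|f i - sigma i j * f j| `^ p)
   + \sum_(i : 'I_n) kappa i * (`|f i| `^ p))
  / (\sum_(i : 'I_n) mu i * (`|f i| `^ p)).

Definition Sp (mu : 'I_n -> R) (p : R) : set ('I_n -> R) :=
  [set f | \sum_(i : 'I_n) mu i * (`|f i| `^ p) = 1].

Definition lambda_top (e : rel 'I_n) (sigma w : 'I_n -> 'I_n -> R)
  (mu kappa : 'I_n -> R) (p : R) : R :=
  sup [set rayleigh e sigma w mu kappa p f | f in Sp mu p].

(* A_Gamma^mu = diag(mu)^{-1} A_Gamma, entries sigma_ij w_ij / mu_i on edges *)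
Definition adj_mu (e : rel 'I_n) (sigma w : 'I_n -> 'I_n -> R) (mu : 'I_n -> R) :
  'I_n -> 'I_n -> R :=
  fun i j => if e i j then sigma i j * w i j / mu i else 0.

Definition is_mx_eigenpair (M : 'I_n -> 'I_n -> R) (lam : R) (g : 'I_n -> R) : Prop :=
  (exists i, g i != 0) /\ (forall i, \sum_(j : 'I_n) M i j * g j = lam * g i).

(* lam is the largest eigenvalue lambda_n of M (all eigenvalues of A^mu are real) *)
Definition is_largest_eigenvalue (M : 'I_n -> 'I_n -> R) (lam : R) : Prop :=
  (exists g, is_mx_eigenpair M lam g) /\
  (forall a g, is_mx_eigenpair M a g -> a <= lam).

End Defs.

(* Main.v *)
(* With g_i = |f_i|^{p/2}, the p-th power mean ((a + b) / 2)^p of a = |f_i| and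
   b = |f_j| exceeds g_i g_j by at most (8 / p) (a^p + b^p).  As f^(p) maximizes the
   Rayleigh quotient, comparing it, after division by 2^p, with its value at h^{2/p}
   for the normalized positive Perron vector h of the weighted adjacency matrix shows
   that g is an O(1/p)-maximizer of sum_ij W_ij g_i g_j on the unit sphere of
   l^2(mu).  The deficit equals (1/2) sum_ij W_ij h_i h_j (g_i/h_i - g_j/h_j)^2, so
   the ratios g_i/h_i equalize along edges; by connectedness and normalization they
   all tend to 1. *)
Require Import Defs.
From HB Require Import structures.
From mathcomp Require Import all_boot all_order all_algebra.
From mathcomp Require Import all_classical all_reals all_analysis.
From mathcomp Require Import ring lra.
Set Implicit Arguments. Unset Strict Implicit. Unset Printing Implicit Defensive.
Import Order.TTheory GRing.Theory Num.Theory numFieldNormedType.Exports.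
Local Open Scope ring_scope.
Local Open Scope classical_set_scope.

(** * Powers of the arithmetic mean against the geometric mean *)

(* With u = (1 + s^2) / 2 one has u - s = (1 - s)^2 / 2 and u <= exp (- (1 - s) / 2), so
   the deficit p (1 - s)^2 exp (- p (1 - s) / 2) is O(1/p) uniformly in s. *)
Lemma powR_mean_sqr_le (R : realType) (p s : R) : 0 < p -> 0 <= s -> s <= 1 ->
  ((1 + s ^+ 2) / 2) `^ p <= s `^ p + 8 / p.
Proof.
move=> p0 s0 s1.
set u := (1 + s ^+ 2) / 2.
have u0 : 0 < u by rewrite /u; nra.
set y := p * (1 - s) / 2.
have y0 : 0 <= y by rewrite /y !mulr_ge0 ?subr_ge0// ltW.
have lnu : ln u <= - ((1 - s) / 2).
  rewrite (_ : u = 1 + (u - 1)); last by ring.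
  by apply: (le_trans (le_ln1Dx _)); rewrite /u; nra.
have uE : u `^ p <= expR (- y).
  rewrite /powR gt_eqF// ler_expR /y -mulrA -mulrN.
  by rewrite ler_wpM2l// ltW.
have up0 : 0 <= u `^ p := powR_ge0 _ _.
have sp0 : 0 <= s `^ p := powR_ge0 _ _.
(* Two decay rates of exp(-y), since exp(y) dominates both 1 + y and 1 + y^2 / 2. The first serves s
   < 1/2, the second s >= 1/2. *)
have uy : u `^ p * (1 + y) <= 1 /\ u `^ p * (1 + y ^+ 2 / 2) <= 1.
  have E1 : expR (- y) * expR y = 1 by rewrite mulrC expRxMexpNx_1.
  have e1 := expR_ge1Dx y.
  have e2 : 1 + y ^+ 2 / 2 <= expR y by have := expR_ge1Dxn 1 y0; rewrite (_ : 2`! = 2)%N.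
  have bnd z : 0 <= z -> z <= expR y -> u `^ p * z <= 1.
    by move=> z0 zy; rewrite -E1 ler_pM.
  by split; apply: bnd => //; nra.
have [u1 u2] := uy.
(* For s < 1/2, y > p / 4 makes u^p itself at most 8 / p, and s^p is dropped. For s >= 1/2, the
   factor 1 / s <= 2 keeps u / s - 1 below (1 - s)^2. *)
case: (ltP s (1/2)) => s2.
  have : u `^ p * p <= 8 by rewrite /y in u1; nra.
  by rewrite -ler_pdivlMr//; lra.
have sgt0 : 0 < s by lra.
have lnus : ln (u / s) <= (1 - s) ^+ 2.
  rewrite (_ : u / s = 1 + (u / s - 1)); last by ring.
  have us : u / s - 1 = (1 - s) ^+ 2 / 2 / s by rewrite /u; field; lra.
  have us0 : 0 <= u / s - 1 by rewrite us !divr_ge0 ?sqr_ge0.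
  apply: (le_trans (le_ln1Dx _)); first by lra.
  rewrite us ler_pdivrMr//; have := sqr_ge0 (1 - s); nra.
have sE : s `^ p = u `^ p * expR (- (p * ln (u / s))).
  rewrite /powR !gt_eqF// -expRD ln_div//; congr expR; ring.
have e3 : 1 - p * ln (u / s) <= expR (- (p * ln (u / s))) := expR_ge1Dx _.
have e4 : 1 - p * (1 - s) ^+ 2 <= expR (- (p * ln (u / s))).
  by apply: le_trans e3; rewrite lerB// ler_wpM2l// ltW.
have e5 : u `^ p * (1 - p * (1 - s) ^+ 2) <= s `^ p by rewrite sE ler_wpM2l.
(* The constant 8 arises here: y^2 / 2 = p^2 (1 - s)^2 / 8. *)
have e6 : u `^ p * (p * (1 - s) ^+ 2) <= 8 / p.
  by rewrite ler_pdivlMr//; rewrite /y in u2; nra.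
lra.
Qed.

(** By homogeneity: with a <= b, b > 0 and s^2 = a / b, one has a + b = b (1 + s^2) and a b = (b
    s)^2, so b^p factors out. *)
Lemma powR_mean_le (R : realType) (p a b : R) : 0 < p -> 0 <= a -> 0 <= b ->
  ((a + b) / 2) `^ p <= (a * b) `^ (p / 2) + 8 / p * (a `^ p + b `^ p).
Proof.
move=> p0; wlog ab : a b / a <= b => [hw a0 b0|a0 b0].
  have [ab|/ltW ba] := leP a b; first exact: hw.
  by rewrite addrC (mulrC a) (addrC (a `^ p)); exact: hw.
have b_pos : 0 < b \/ a = 0 /\ b = 0.
  by case: (ltgtP 0 b) b0 ab => // [|<- _ ab]; [left|right; split => //; apply/le_anti/andP].
case: b_pos => [b_pos|[-> ->]]; last first.
  by rewrite add0r !mul0r !powR0 ?gt_eqF ?divr_gt0// !add0r mulr0.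
set s := Num.sqrt (a / b).
have s0 : 0 <= s := sqrtr_ge0 _.
have sE : s ^+ 2 = a / b by rewrite sqr_sqrtr// divr_ge0.
have s1 : s <= 1 by rewrite -(ler_pXn2r (_ : (0 < 2)%N)) ?nnegrE// expr1n sE ler_pdivrMr// mul1r.
have -> : (a + b) / 2 = b * ((1 + s ^+ 2) / 2) by rewrite sE; field; lra.
have -> : a * b = (b * s) ^+ 2 by rewrite exprMn sE; field; lra.
rewrite -powR_mulrn ?mulr_ge0// -powRrM (_ : 2%:R * (p / 2) = p); last by field.
rewrite (@powRM _ b s)// (@powRM _ b ((1 + _) / 2))//; last first.
  by rewrite divr_ge0// addr_ge0 ?sqr_ge0.
apply: (@le_trans _ _ (b `^ p * (s `^ p + 8 / p))).
  by rewrite ler_wpM2l ?powR_ge0// powR_mean_sqr_le.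
rewrite mulrDr lerD2l mulrC ler_wpM2l ?divr_ge0 ?(ltW p0)//.
by rewrite lerDr powR_ge0.
Qed.

(** * Quadratic forms in l^2(mu) and the Perron vector *)

Definition wdot {R : realType} {n : nat} (mu x y : 'I_n -> R) : R :=
  \sum_i mu i * x i * y i.

Definition bilin {R : realType} {n : nat} (W : 'I_n -> 'I_n -> R)
    (x y : 'I_n -> R) : R :=
  \sum_i \sum_j W i j * x i * y j.

Section Perron.
Variables (R : realType) (n : nat) (W : 'I_n -> 'I_n -> R) (mu : 'I_n -> R).
Hypothesis mu_gt0 : forall i, 0 < mu i.

Lemma wdot_ge0 x : 0 <= wdot mu x x.
Proof.
by apply: sumr_ge0 => i _; rewrite -mulrA mulr_ge0 ?(ltW (mu_gt0 i))// -expr2 sqr_ge0.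
Qed.

Lemma wdot_eq0 x : wdot mu x x = 0 -> forall i, x i = 0.
Proof.
move=> /eqP; rewrite psumr_eq0; last first.
  by move=> i _; rewrite -mulrA mulr_ge0 ?(ltW (mu_gt0 i))// -expr2 sqr_ge0.
move=> /allP h i; have := h i (mem_index_enum _).
by rewrite -mulrA mulf_eq0 gt_eqF//= mulf_eq0 orbb => /eqP.
Qed.

Lemma wdotZ c x : wdot mu (fun i => c * x i) (fun i => c * x i) = c ^+ 2 * wdot mu x x.
Proof. by rewrite /wdot mulr_sumr; apply: eq_bigr => i _; ring. Qed.

Lemma bilinZ c x : bilin W (fun i => c * x i) (fun i => c * x i) = c ^+ 2 * bilin W x x.
Proof.
rewrite /bilin mulr_sumr; apply: eq_bigr => i _; rewrite mulr_sumr.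
by apply: eq_bigr => j _; ring.
Qed.

Lemma wdot_continuous : continuous (fun x : 'rV[R]_n => wdot mu (x ord0) (x ord0)).
Proof.
apply: continuous_big => [|i _ x]; first exact: add_continuous.
apply: (@continuousM _ _ (fun x : 'rV[R]_n => mu i * x ord0 i)); last first.
  exact: coord_continuous.
by apply: (@continuousM _ _ (fun=> mu i)); [exact: cst_continuous|exact: coord_continuous].
Qed.

Lemma bilin_continuous : continuous (fun x : 'rV[R]_n => bilin W (x ord0) (x ord0)).
Proof.
apply: continuous_big => [|i _]; first exact: add_continuous.
apply: continuous_big => [|j _ x]; first exact: add_continuous.
apply: (@continuousM _ _ (fun x : 'rV[R]_n => W i j * x ord0 i)); last first.
  exact: coord_continuous.
by apply: (@continuousM _ _ (fun=> W i j)); [exact: cst_continuous|exact: coord_continuous].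
Qed.

Lemma compact_wsphere : compact [set x : 'rV[R]_n | wdot mu (x ord0) (x ord0) = 1].
Proof.
apply: bounded_closed_compact.
  (* On the sphere x_j^2 <= 1 / mu_j, and |t| <= 1 + t^2. *)
  exists (1 + \sum_i (mu i)^-1); split; first exact: num_real.
  move=> M MS x /= x1; rewrite [leLHS]mx_normrE.
  apply/bigmax_leP; split => [|[i j] _] /=.
    by apply/ltW/(le_lt_trans _ MS); rewrite addr_ge0// sumr_ge0// => i _; rewrite invr_ge0 ltW.
  rewrite (ord1 i); apply/ltW/(le_lt_trans _ MS).
  have xj : x ord0 j ^+ 2 <= (mu j)^-1.
    rewrite -[leRHS]mul1r ler_pdivlMr// -x1 /wdot (bigD1 j)//= mulrC expr2 mulrA lerDl.
    by apply: sumr_ge0 => k _; rewrite -mulrA mulr_ge0 ?(ltW (mu_gt0 k))// -expr2 sqr_ge0.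
  have : (mu j)^-1 <= \sum_i (mu i)^-1.
    by rewrite (bigD1 j)//= lerDl sumr_ge0// => k _; rewrite invr_ge0 ltW.
  have := real_normK (num_real (x ord0 j)); nra.
apply: (@preimage_closed _ _ (fun x : 'rV[R]_n => wdot mu (x ord0) (x ord0)) [set y | y = 1]).
  by move=> x _; exact: wdot_continuous.
exact: closed_eq.
Qed.

Hypothesis W_sym : forall i j, W i j = W j i.

Lemma bilinC x y : bilin W x y = bilin W y x.
Proof.
rewrite /bilin exchange_big; apply: eq_bigr => i _; apply: eq_bigr => j _.
by rewrite W_sym; ring.
Qed.

Lemma bilinDZ x y t : bilin W (fun i => x i + t * y i) (fun i => x i + t * y i) =
  bilin W x x + 2 * t * bilin W x y + t ^+ 2 * bilin W y y.
Proof.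
have -> : 2 * t * bilin W x y = t * bilin W x y + t * bilin W y x.
  by rewrite (bilinC y); ring.
rewrite /bilin !mulr_sumr -!big_split/=; apply: eq_bigr => i _.
by rewrite !mulr_sumr -!big_split/=; apply: eq_bigr => j _; ring.
Qed.

Lemma wdotDZ x y t : wdot mu (fun i => x i + t * y i) (fun i => x i + t * y i) =
  wdot mu x x + 2 * t * wdot mu x y + t ^+ 2 * wdot mu y y.
Proof.
by rewrite /wdot !mulr_sumr -!big_split/=; apply: eq_bigr => i _; ring.
Qed.

(** The form lam * wdot - bilin is nonnegative and vanishes at h, so its gradient at h is zero. *)
Lemma bilin_le_wdot_critical lam h :
  (forall x, bilin W x x <= lam * wdot mu x x) -> bilin W h h = lam * wdot mu h h ->
  forall i, \sum_j W i j * h j = lam * mu i * h i.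
Proof.
move=> ub hE i.
(* First variation of the form lam * wdot - bilin at h in the direction of its own
   gradient r. *)
pose r k := lam * mu k * h k - \sum_j W k j * h j.
pose S := \sum_k r k ^+ 2.
have SE : lam * wdot mu h r - bilin W h r = S.
  rewrite bilinC /wdot /bilin mulr_sumr -sumrB; apply: eq_bigr => k _.
  rewrite (_ : r k ^+ 2 = r k * (lam * mu k * h k - \sum_j W k j * h j))//.
  rewrite [RHS]mulrBr; congr (_ - _); first by ring.
  by rewrite mulr_sumr; apply: eq_bigr => j _; ring.
have S0 : 0 <= S by apply: sumr_ge0 => k _; rewrite sqr_ge0.
pose T := lam * wdot mu r r - bilin W r r.
have T0 : 0 <= T by rewrite subr_ge0.
have tS t : 0 <= 2 * t * S + t ^+ 2 * T.
  have := ub (fun k => h k + t * r k); rewrite bilinDZ wdotDZ hE -SE /T; nra.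
(* The choice t = -S / (T + 1), well defined even if T = 0, makes the quadratic in t equal to -S^2
   (T + 2) / (T + 1)^2, which forces S = 0. *)
have : 0 <= S * (- (T + 2)).
  have := tS (- S / (T + 1)).
  have -> : 2 * (- S / (T + 1)) * S + (- S / (T + 1)) ^+ 2 * T =
     S * (S * (- (T + 2))) / (T + 1) ^+ 2 by field; lra.
  rewrite pmulr_lge0; last by rewrite invr_gt0 exprn_gt0//; lra.
  by case: (ltgtP 0 S) S0 => // [S_gt0 _|<- _]; [rewrite pmulr_rge0|rewrite !mul0r].
have {}S0' : S = 0 -> \sum_j W i j * h j = lam * mu i * h i.
  move=> /eqP; rewrite psumr_eq0; last by move=> k _; rewrite sqr_ge0.
  move=> /allP/(_ i (mem_index_enum _)); rewrite sqrf_eq0 subr_eq0.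
  by move=> /eqP ->.
by move=> ST; apply: S0'; nra.
Qed.

(** The form attains its maximum on the compact unit sphere, nonempty because n > 0; homogeneity
    extends the bound to all vectors. *)
Lemma bilin_le_wdot_max : (0 < n)%N -> exists lam h,
  [/\ forall x, bilin W x x <= lam * wdot mu x x, wdot mu h h = 1 & bilin W h h = lam].
Proof.
move=> n0.
have scale x : 0 < wdot mu x x ->
    wdot mu (fun i => (Num.sqrt (wdot mu x x))^-1 * x i)
            (fun i => (Num.sqrt (wdot mu x x))^-1 * x i) = 1.
  by move=> x0; rewrite wdotZ exprVn sqr_sqrtr ?(ltW x0)// mulVf// gt_eqF.
have toE (y : 'I_n -> R) : (\row_j y j : 'rV[R]_n) ord0 = y.
  by apply/funext => i; rewrite mxE.
have [|c /set_mem /= c1 cmax] := EVT_max_rV _ compact_wsphere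
    (continuous_subspaceT bilin_continuous).
  pose x := fun _ : 'I_n => 1 : R.
  exists (\row_i ((Num.sqrt (wdot mu x x))^-1 * x i)) => /=; rewrite toE.
  apply: scale; rewrite lt0r wdot_ge0 andbT; apply/eqP => /wdot_eq0 /(_ (Ordinal n0)).
  by apply/eqP; rewrite oner_eq0.
exists (bilin W (c ord0) (c ord0)), (c ord0); split => // x.
have := wdot_ge0 x; rewrite le_eqVlt => /predU1P[/esym x0|x0].
  rewrite x0 mulr0 /bilin big1// => i _; rewrite big1// => j _.
  by rewrite (wdot_eq0 x0 i) mulr0 mul0r.
have := cmax (\row_i ((Num.sqrt (wdot mu x x))^-1 * x i)).
rewrite !toE bilinZ exprVn sqr_sqrtr ?(ltW x0)// mulrC ler_pdivrMr//.
by apply; rewrite inE/= toE scale.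
Qed.

Hypothesis W_ge0 : forall i j, 0 <= W i j.

Lemma bilin_norm x : bilin W x x <= bilin W (fun i => `|x i|) (fun i => `|x i|).
Proof.
apply: ler_sum => i _; apply: ler_sum => j _.
by rewrite -!mulrA ler_wpM2l// -normrM ler_norm.
Qed.

Lemma wdot_norm x : wdot mu (fun i => `|x i|) (fun i => `|x i|) = wdot mu x x.
Proof.
by apply: eq_bigr => i _; rewrite -!mulrA -normrM ger0_norm// -expr2 sqr_ge0.
Qed.

Hypothesis W_conn : forall i j, connect [rel i j | 0 < W i j] i j.

(** As W >= 0, the absolute value of a maximizer is again a maximizer, hence satisfies the
    eigenvalue equation. Where it vanishes, that equation is a zero sum of nonnegative terms, so it
    vanishes at all neighbours, and by connectedness everywhere, against the normalization. *)
Lemma perron_vector : (0 < n)%N -> exists lam h,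
  [/\ forall i, 0 < h i, wdot mu h h = 1 &
      forall i, \sum_j W i j * h j = lam * mu i * h i].
Proof.
move=> /bilin_le_wdot_max[lam [x [ub x1 xE]]].
pose h i := `|x i|; exists lam, h.
have h1 : wdot mu h h = 1 by rewrite wdot_norm.
have hcrit : forall i, \sum_j W i j * h j = lam * mu i * h i.
  apply: bilin_le_wdot_critical => //; apply/le_anti.
  by rewrite ub/= h1 mulr1 -xE bilin_norm.
have h0 i : 0 <= h i by exact: normr_ge0.
split => // i; rewrite lt0r h0 andbT; apply/negP => /eqP hi.
have step k j : 0 < W k j -> h k = 0 -> h j = 0.
  move=> Wkj hk; have := hcrit k; rewrite hk mulr0 => /eqP.
  rewrite psumr_eq0; last by move=> l _; rewrite mulr_ge0.
  move=> /allP/(_ j (mem_index_enum _)); rewrite mulf_eq0 gt_eqF//=.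
  by move=> /eqP.
have all0 j : h j = 0.
  have /connectP[p pth ->] := W_conn i j.
  elim: p i hi pth => //= k p ih i hi /andP[Wik]; apply: ih.
  exact: step hi.
move: h1; rewrite /wdot big1 => [/eqP|j _]; last by rewrite all0 mulr0.
by rewrite eq_sym oner_eq0.
Qed.

(** Ground-state representation: after expanding (u_i - u_j)^2, each square term sums to lam * wdot
    by the equation for h, and the cross term is -2 bilin. *)
Lemma ground_state lam h u : (forall i, \sum_j W i j * h j = lam * mu i * h i) ->
  lam * wdot mu (fun i => h i * u i) (fun i => h i * u i) -
    bilin W (fun i => h i * u i) (fun i => h i * u i) =
  2^-1 * \sum_i \sum_j W i j * h i * h j * (u i - u j) ^+ 2.
Proof.
move=> hE.
have diag : \sum_i \sum_j W i j * h i * h j * u i ^+ 2 =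
    lam * wdot mu (fun i => h i * u i) (fun i => h i * u i).
  rewrite /wdot mulr_sumr; apply: eq_bigr => i _.
  transitivity (h i * u i ^+ 2 * \sum_j W i j * h j).
    by rewrite mulr_sumr; apply: eq_bigr => j _; ring.
  by rewrite hE; ring.
have diag' : \sum_i \sum_j W i j * h i * h j * u j ^+ 2 =
    \sum_i \sum_j W i j * h i * h j * u i ^+ 2.
  rewrite exchange_big; apply: eq_bigr => i _; apply: eq_bigr => j _.
  by rewrite W_sym; ring.
have -> : \sum_i \sum_j W i j * h i * h j * (u i - u j) ^+ 2 =
  \sum_i \sum_j W i j * h i * h j * u i ^+ 2
  + \sum_i \sum_j W i j * h i * h j * u j ^+ 2
  - 2 * bilin W (fun i => h i * u i) (fun i => h i * u i).
  rewrite /bilin mulr_sumr -big_split -sumrB/=; apply: eq_bigr => i _.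
  by rewrite mulr_sumr -big_split -sumrB/=; apply: eq_bigr => j _; ring.
by rewrite diag' diag; field.
Qed.

End Perron.

(** * Auxiliary facts on powers and edge sums *)

Lemma Psi_mul (R : realType) (p t : R) : p != 0 -> Psi p t * t = `|t| `^ p.
Proof.
move=> p0; rewrite /Psi; case: eqVneq => [->|t0].
  by rewrite mul0r normr0 powR0.
rewrite [in RHS](_ : p = (p - 2) + 2); last by ring.
rewrite [RHS]powRD ?normr_eq0 ?t0 ?implybT//.
by rewrite powR_mulrn// real_normK ?num_real// expr2 mulrA.
Qed.

Lemma powR_half_sqr (R : realType) (a p : R) : (a `^ (p / 2)) ^+ 2 = a `^ p.
Proof. by rewrite -powR_mulrn ?powR_ge0// -powRrM; congr powR; field. Qed.

(** The inequality a b <= ((a + b) / 2)^2 raised to the power p / 2; the counterpart of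
    [powR_mean_le], without error term. *)
Lemma powR_mean_ge (R : realType) (p a b : R) : 0 <= p -> 0 <= a -> 0 <= b ->
  (a * b) `^ (p / 2) <= ((a + b) / 2) `^ p.
Proof.
move=> p0 a0 b0; have ab0 : 0 <= (a + b) / 2 by rewrite divr_ge0 ?addr_ge0.
rewrite [in leRHS](_ : p = 2 * (p / 2)); last by field.
rewrite [leRHS]powRrM powR_mulrn//.
apply: ge0_ler_powR; rewrite ?nnegrE ?mulr_ge0 ?exprn_ge0 ?invr_ge0// ?addr_ge0//.
have := sqr_ge0 (a - b); nra.
Qed.

(** From exp(x) >= 1 + x and ln 2 >= 1/2. Thus quantities bounded in p become O(1/p) after division
    by 2^p. *)
Lemma le_powR2 (R : realType) (p : R) : 0 <= p -> p / 2 <= 2 `^ p.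
Proof.
move=> p0; have ln2 : 1 / 2 <= ln 2 :> R.
  have := @le_ln1Dx R (- (1 / 2)).
  rewrite (_ : 1 - 1 / 2 = 2^-1); last by field.
  rewrite lnV ?posrE//; lra.
have := expR_ge1Dx (p * ln 2); rewrite /powR gt_eqF//; nra.
Qed.

(** Passes from edges counted once, as in [rayleigh], to the ordered pairs over which the quadratic
    forms are summed. *)
Lemma sum_edges_double (R : realType) (n : nat) (e : rel 'I_n) (F : 'I_n -> 'I_n -> R) :
  simple_graph e -> (forall i j, e i j -> F i j = F j i) ->
  \sum_i \sum_(j | e i j) F i j =
    2 * \sum_(i : 'I_n) \sum_(j : 'I_n | (i < j)%N && e i j) F i j.
Proof.
move=> [e_sym e_irr] F_sym.
have -> : \sum_i \sum_(j | e i j) F i j =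
    \sum_(i : 'I_n) \sum_(j : 'I_n | (i < j)%N && e i j) F i j +
    \sum_(i : 'I_n) \sum_(j : 'I_n | (j < i)%N && e i j) F i j.
  rewrite -big_split/=; apply: eq_bigr => i _.
  rewrite (bigID (fun j : 'I_n => (i < j)%N))/=; congr (_ + _).
    by apply: eq_bigl => j; rewrite andbC.
  apply: eq_bigl => j; rewrite andbC -leqNgt leq_eqVlt.
  have [/eqP/val_inj ->|//] := boolP (val j == val i).
  by rewrite (negbTE (e_irr i)) !andbF.
rewrite mulrDl !mul1r; congr (_ + _).
rewrite (exchange_big_dep xpredT)//=; apply: eq_bigr => i _.
by apply: eq_big => [j|j /andP[_ eji]]; rewrite 1?e_sym 1?F_sym// e_sym.
Qed.

(** * Energy estimates when sigma = -1 on every edge *)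

Section SignlessLaplacian.
Variables (R : realType) (n : nat) (e : rel 'I_n).
Variables (sigma w : 'I_n -> 'I_n -> R) (mu kappa : 'I_n -> R).
Hypothesis graph : signed_weighted_graph e sigma w mu.
Hypothesis sigmaN1 : forall i j, e i j -> sigma i j = -1.

(** The adjacency matrix of -Gamma, kept symmetric by leaving out the division by mu. *)
Definition adj : 'I_n -> 'I_n -> R := fun i j => if e i j then w i j else 0.

Let e_simple : simple_graph e := graph.1.
Let e_sym : forall i j, e i j = e j i := e_simple.1.
Let w_sym i j (eij : e i j) : w i j = w j i := (graph.2.2.1 i j eij).1.
Let w_gt0 i j (eij : e i j) : 0 < w i j := (graph.2.2.1 i j eij).2.
Let mu_gt0 : forall i, 0 < mu i := graph.2.2.2.

Lemma adj_sym i j : adj i j = adj j i.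
Proof. by rewrite /adj (e_sym j i); case: ifP => // /w_sym. Qed.

Lemma adj_gt0 i j : (0 < adj i j) = e i j.
Proof. by rewrite /adj; case: ifP => [/w_gt0//|_]; rewrite ltxx. Qed.

Lemma adj_ge0 i j : 0 <= adj i j.
Proof. by rewrite /adj; case: ifP => // /w_gt0/ltW. Qed.

Lemma sum_adj (F : 'I_n -> 'I_n -> R) i :
  \sum_j adj i j * F i j = \sum_(j | e i j) w i j * F i j.
Proof.
rewrite [RHS]big_mkcond/=; apply: eq_bigr => j _.
by rewrite /adj; case: ifP; rewrite ?mul0r.
Qed.

(** The numerator of the Rayleigh quotient for sigma = -1; the factor 1/2 corrects for ordered
    pairs. *)
Definition energy (p : R) (f : 'I_n -> R) : R :=
  2^-1 * (\sum_i \sum_j adj i j * `|f i + f j| `^ p)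
  + \sum_i kappa i * `|f i| `^ p.

Lemma rayleigh_energy p f : Sp mu p f ->
  rayleigh e sigma w mu kappa p f = energy p f.
Proof.
rewrite /Sp/= /rayleigh /energy => ->; rewrite divr1; congr (_ + _).
have -> : \sum_i \sum_j adj i j * `|f i + f j| `^ p =
    \sum_i \sum_(j | e i j) w i j * `|f i - sigma i j * f j| `^ p.
  apply: eq_bigr => i _; rewrite (sum_adj (fun i j => `|f i + f j| `^ p)).
  by apply: eq_bigr => j eij; rewrite sigmaN1// mulN1r opprK.
rewrite (sum_edges_double (e := e))//; first by rewrite mulrA mulVf ?mul1r.
move=> i j eij; have eji : e j i by rewrite e_sym.
by rewrite w_sym// (sigmaN1 eij) (sigmaN1 eji) !mulN1r !opprK addrC.
Qed.

(** The eigenvalue equation is multiplied by f i and summed; exchanging i and j shows that the edge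
    part is half the double sum of |f i + f j|^p. *)
Lemma eigenvalue_energy p f lam : p != 0 -> Sp mu p f ->
  is_p_eigenfunction e sigma w mu kappa p f lam -> lam = energy p f.
Proof.
move=> p0 f1 [_ fE].
pose L := \sum_i \sum_j adj i j * (Psi p (f i + f j) * f i).
have LE : L = 2^-1 * \sum_i \sum_j adj i j * `|f i + f j| `^ p.
  have -> : \sum_i \sum_j adj i j * `|f i + f j| `^ p =
      L + \sum_i \sum_j adj i j * (Psi p (f i + f j) * f j).
    rewrite -big_split/=; apply: eq_bigr => i _; rewrite -big_split/=.
    by apply: eq_bigr => j _; rewrite -Psi_mul//; ring.
  have -> : \sum_i \sum_j adj i j * (Psi p (f i + f j) * f j) = L.
    rewrite exchange_big; apply: eq_bigr => i _; apply: eq_bigr => j _.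
    by rewrite adj_sym (addrC (f i)).
  by field.
rewrite /energy -LE -[LHS]mulr1 -[in LHS]f1 mulr_sumr /L -big_split/=.
apply: eq_bigr => i _; rewrite -!Psi_mul//.
transitivity (lam * mu i * Psi p (f i) * f i); first by ring.
rewrite -fE /pLap mulrDl -[X in _ + X]mulrA.
congr (_ + _); rewrite mulr_suml (sum_adj (fun i j => Psi p (f i + f j) * f i)).
by apply: eq_bigr => j eij; rewrite sigmaN1// mulN1r opprK mulrA.
Qed.

Lemma Sp_powR_le p f i : Sp mu p f -> `|f i| `^ p <= (mu i)^-1.
Proof.
move=> f1; rewrite -[leRHS]mul1r ler_pdivlMr// -f1 (bigD1 i)//= mulrC lerDl.
by apply: sumr_ge0 => j _; rewrite mulr_ge0 ?powR_ge0 ?ltW.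
Qed.

(** This constant and the next are independent of p; they come from |f i|^p <= 1 / mu i on the
    sphere. *)
Definition potential_bound : R := \sum_i `|kappa i| / mu i.

Definition edge_bound : R := \sum_i \sum_j adj i j * ((mu i)^-1 + (mu j)^-1).

Lemma potential_le p f : Sp mu p f ->
  `|\sum_i kappa i * `|f i| `^ p| <= potential_bound.
Proof.
move=> f1; apply: (le_trans (ler_norm_sum _ _ _)); apply: ler_sum => i _.
by rewrite normrM ler_wpM2l// ger0_norm ?powR_ge0// Sp_powR_le.
Qed.

(** Each edge term is at most 2^p times the p-th power of the mean of |f i| and |f j|, to which
    [powR_mean_le] applies. *)
Lemma energy_le p f : 0 < p -> Sp mu p f ->
  energy p f <= 2^-1 * 2 `^ p *
    (bilin adj (fun i => `|f i| `^ (p / 2)) (fun i => `|f i| `^ (p / 2))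
      + 8 / p * edge_bound) + potential_bound.
Proof.
move=> p0 f1; apply: lerD; last exact: (le_trans (ler_norm _) (potential_le f1)).
rewrite -mulrA ler_wpM2l ?invr_ge0// /bilin /edge_bound mulr_sumr -big_split mulr_sumr.
apply: ler_sum => i _; rewrite /= mulr_sumr -big_split mulr_sumr.
apply: ler_sum => j _ /=.
have h1 : `|f i + f j| `^ p <= 2 `^ p * ((`|f i| + `|f j|) / 2) `^ p.
  rewrite -powRM ?divr_ge0 ?addr_ge0// (_ : 2 * (_ / 2) = `|f i| + `|f j|); last by field.
  by apply: ge0_ler_powR; rewrite ?nnegrE ?addr_ge0 ?ler_normD// ltW.
have := powR_mean_le p0 (normr_ge0 (f i)) (normr_ge0 (f j)).
rewrite (@powRM _ `|f i| `|f j|)// => h2.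
have h3 : 8 / p * (`|f i| `^ p + `|f j| `^ p) <= 8 / p * ((mu i)^-1 + (mu j)^-1).
  by rewrite ler_wpM2l ?divr_ge0 ?(ltW p0)// lerD ?Sp_powR_le.
apply: (@le_trans _ _ (adj i j * (2 `^ p *
    (`|f i| `^ (p / 2) * `|f j| `^ (p / 2) + 8 / p * ((mu i)^-1 + (mu j)^-1))))).
  rewrite ler_wpM2l ?adj_ge0//; apply: (le_trans h1).
  by rewrite ler_wpM2l ?powR_ge0//; apply: (le_trans h2); rewrite lerD2l.
by rewrite le_eqVlt; apply/orP; left; apply/eqP; ring.
Qed.

(** The test function is chosen so that its power p / 2 is h. *)
Lemma Sp_test p h : 0 < p -> (forall i, 0 <= h i) -> wdot mu h h = 1 ->
  Sp mu p (fun i => h i `^ (2 / p)).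
Proof.
move=> p0 h0 h1; rewrite /Sp/= -[RHS]h1; apply: eq_bigr => i _.
rewrite ger0_norm ?powR_ge0// -powRrM (_ : 2 / p * p = 2); last by field; lra.
by rewrite powR_mulrn// expr2 mulrA.
Qed.

Lemma energy_test_ge p h : 0 < p -> (forall i, 0 <= h i) -> wdot mu h h = 1 ->
  2^-1 * 2 `^ p * bilin adj h h - potential_bound <= energy p (fun i => h i `^ (2 / p)).
Proof.
move=> p0 h0 h1; apply: lerD; last first.
  by rewrite lerNl; apply: (le_trans _ (potential_le (Sp_test p0 h0 h1)));
    rewrite -normrN ler_norm.
rewrite -mulrA ler_wpM2l ?invr_ge0// /bilin mulr_sumr.
apply: ler_sum => i _; rewrite mulr_sumr; apply: ler_sum => j _.
rewrite -mulrA mulrCA ler_wpM2l ?adj_ge0//.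
rewrite ger0_norm ?addr_ge0 ?powR_ge0//.
set a := h i `^ _; set b := h j `^ _.
have -> : a + b = 2 * ((a + b) / 2) by field.
rewrite powRM ?divr_ge0 ?addr_ge0 ?powR_ge0// ler_wpM2l ?powR_ge0//.
apply: le_trans (powR_mean_ge (ltW p0) (powR_ge0 _ _) (powR_ge0 _ _)).
rewrite powRM ?powR_ge0// /a /b -!powRrM (_ : 2 / p * (p / 2) = 1); last by field; lra.
by rewrite !powRr1.
Qed.

Lemma wdot_powR_half p f : Sp mu p f ->
  wdot mu (fun i => `|f i| `^ (p / 2)) (fun i => `|f i| `^ (p / 2)) = 1.
Proof.
by move=> f1; rewrite -[RHS]f1; apply: eq_bigr => i _; rewrite -mulrA -expr2 powR_half_sqr.
Qed.

(** * The spectral deficit of |f|^(p/2) relative to the ground state h *)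

Section GroundState.
Variables (lam : R) (h : 'I_n -> R).
Hypotheses (h_gt0 : forall i, 0 < h i) (h1 : wdot mu h h = 1).
Hypothesis hE : forall i, \sum_j adj i j * h j = lam * mu i * h i.

Lemma ground_state_div g :
  lam * wdot mu g g - bilin adj g g =
  2^-1 * \sum_i \sum_j adj i j * h i * h j * (g i / h i - g j / h j) ^+ 2.
Proof.
rewrite -(ground_state adj_sym (fun i => g i / h i) hE).
have -> // : (fun i => h i * (g i / h i)) = g.
by apply/funext => i; rewrite mulrCA divff ?mulr1// gt_eqF.
Qed.

Lemma bilin_le_wdot g : bilin adj g g <= lam * wdot mu g g.
Proof.
rewrite -subr_ge0 ground_state_div mulr_ge0 ?invr_ge0//.
apply: sumr_ge0 => i _; apply: sumr_ge0 => j _.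
by rewrite mulr_ge0 ?sqr_ge0// !mulr_ge0 ?adj_ge0 ?(ltW (h_gt0 _)).
Qed.

Lemma bilin_ground_state : bilin adj h h = lam.
Proof.
rewrite -[RHS]mulr1 -h1 /wdot mulr_sumr; apply: eq_bigr => i _.
transitivity (h i * \sum_j adj i j * h j).
  by rewrite mulr_sumr; apply: eq_bigr => j _; ring.
by rewrite hE; ring.
Qed.

Lemma lambda_top_ge p : 0 < p ->
  2^-1 * 2 `^ p * lam - potential_bound <= lambda_top e sigma w mu kappa p.
Proof.
move=> p0; have h0 i : 0 <= h i by exact: ltW.
rewrite -{1}bilin_ground_state; apply: (le_trans (energy_test_ge p0 h0 h1)).
have ht := Sp_test p0 h0 h1.
apply: ub_le_sup; last by eexists; [exact: ht|exact: rayleigh_energy].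
(* A supremum dominates the test value only if the set is bounded above; this bound combines
   [energy_le] with [bilin_le_wdot]. *)
exists (2^-1 * 2 `^ p * (lam + 8 / p * edge_bound) + potential_bound) => _ [f f1 <-].
rewrite rayleigh_energy//; apply: (le_trans (energy_le p0 f1)).
rewrite lerD2r ler_wpM2l ?mulr_ge0 ?invr_ge0 ?powR_ge0// lerD2r.
by apply: (le_trans (bilin_le_wdot _)); rewrite wdot_powR_half// mulr1.
Qed.

(** One nonnegative term of the sum in [ground_state_div] is at most the whole, which is twice the
    deficit lam - B. The deficit is bounded by comparing [lambda_top_ge] with [energy_le] for f,
    whose energy is the top eigenvalue. *)
Lemma edge_gap_le p f i j : 0 < p -> Sp mu p f ->
  is_p_eigenfunction e sigma w mu kappa p f (lambda_top e sigma w mu kappa p) ->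
  adj i j * h i * h j * (`|f i| `^ (p / 2) / h i - `|f j| `^ (p / 2) / h j) ^+ 2
    <= 16 * (edge_bound + potential_bound) / p.
Proof.
move=> p0 f1 fE; set g := fun i => `|f i| `^ (p / 2).
pose T k l := adj k l * h k * h l * (g k / h k - g l / h l) ^+ 2.
have T0 k l : 0 <= T k l.
  by rewrite mulr_ge0 ?sqr_ge0// !mulr_ge0 ?adj_ge0 ?(ltW (h_gt0 _)).
have Tle : T i j <= \sum_k \sum_l T k l.
  rewrite (bigD1 i)//= (bigD1 j)//= -addrA lerDl addr_ge0 ?sumr_ge0// => k _.
  by rewrite sumr_ge0.
apply: (le_trans Tle).
have gs := ground_state_div g; rewrite wdot_powR_half// mulr1 in gs.
have lb := lambda_top_ge p0.
rewrite (eigenvalue_energy (lt0r_neq0 p0) f1 fE) in lb.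
have ub := energy_le p0 f1.
have p2 := le_powR2 (ltW p0).
have K0 : 0 <= potential_bound by apply: sumr_ge0 => k _; rewrite divr_ge0 ?(ltW (mu_gt0 k)).
have {}lb := le_trans lb ub.
set B := bilin adj g g in gs lb; set q := 2 `^ p in p2 lb.
have q0 : 0 < q by rewrite powR_gt0.
have key : q * (lam - B - 8 / p * edge_bound) <= 4 * potential_bound by lra.
(* Since q = 2^p >= p / 2, the potential is absorbed into an O(1/p) term of the same shape as the
   edge error. *)
have Kq : 4 * potential_bound <= q * (8 / p * potential_bound).
  have : 1 <= q * (2 / p) by rewrite mulrA ler_pdivlMr//; lra.
  nra.
have := le_trans key Kq; rewrite ler_pM2l// => gap.
have {}gs : \sum_k \sum_l T k l = 2 * (lam - B) by rewrite gs mulrA divff ?mul1r.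
by rewrite gs; move: gap; rewrite -!(mulrA _ _ (p^-1)); lra.
Qed.

End GroundState.
End SignlessLaplacian.

(** * Passage to the limit along the connected graph *)

(** Triangle inequality along a path, halving eps at each edge. *)
Lemma connect_near_dist (R : realType) (T : finType) (e : rel T) (u : R -> T -> R) :
  (forall i j, e i j -> forall eps, 0 < eps ->
    \forall p \near +oo, `|u p i - u p j| <= eps) ->
  forall i j, connect e i j -> forall eps, 0 < eps ->
    \forall p \near +oo, `|u p i - u p j| <= eps.
Proof.
move=> edge i j /connectP[s es ->]; elim: s i es => [|k s ih] i /=.
  by move=> _ eps eps0; near=> p; rewrite subrr normr0 ltW.
move=> /andP[eik es] eps eps0.
have eps2 : 0 < eps / 2 by rewrite divr_gt0.
have := edge _ _ eik _ eps2; have := ih _ es _ eps2.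
apply: filterS2 => p h1 h2.
by rewrite (le_trans (ler_distD (u p k) _ _))// (splitr eps) lerD.
Unshelve. all: by end_near. Qed.

(** The numbers mu_j h_j^2 are probability weights for which u_j^2 has mean 1; if all u_j lie within
    eps of u_i, then u_i - eps <= 1 <= u_i + eps. *)
Lemma wdot_eq1_dist (R : realType) (n : nat) (mu h u : 'I_n -> R) (eps : R) i :
  (forall j, 0 < mu j) -> wdot mu h h = 1 -> (forall j, 0 <= u j) ->
  wdot mu (fun j => h j * u j) (fun j => h j * u j) = 1 ->
  (forall j, `|u i - u j| <= eps) -> `|u i - 1| <= eps.
Proof.
move=> mu0 h1 u0 hu1 near_i.
have eps0 : 0 <= eps by apply: le_trans (near_i i).
have sqE (c : R) : c ^+ 2 = \sum_j mu j * h j * h j * c ^+ 2.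
  by rewrite -mulr_suml -/(wdot mu h h) h1 mul1r.
have w0 j : 0 <= mu j * h j * h j by rewrite -mulrA -expr2 mulr_ge0 ?sqr_ge0 ?ltW.
have huE : wdot mu (fun j => h j * u j) (fun j => h j * u j) =
    \sum_j mu j * h j * h j * u j ^+ 2 by apply: eq_bigr => j _; ring.
have upper : 1 <= u i + eps.
  have : 1 <= (u i + eps) ^+ 2.
    rewrite sqE -[leLHS]hu1 huE; apply: ler_sum => j _; rewrite ler_wpM2l//.
    have := near_i j; rewrite ler_norml => /andP[? ?].
    by rewrite lerXn2r ?nnegrE ?addr_ge0//; lra.
  have := u0 i; nra.
have lower : u i - eps <= 1.
  (* Squares are compared only when u_i - eps is positive. *)
  have [?|eps_lt] := leP (u i) eps; first lra.
  have : (u i - eps) ^+ 2 <= 1.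
    rewrite sqE -[leRHS]hu1 huE; apply: ler_sum => j _; rewrite ler_wpM2l//.
    have := near_i j; rewrite ler_norml => /andP[? ?].
    by rewrite lerXn2r ?nnegrE//; lra.
  nra.
by rewrite ler_norml; apply/andP; split; lra.
Qed.

Theorem theorem5p3 (R : realType) (n : nat) (e : rel 'I_n)
  (sigma w : 'I_n -> 'I_n -> R) (mu kappa : 'I_n -> R)
  (f : R -> 'I_n -> R) :
  signed_weighted_graph e sigma w mu ->
  connected_graph e ->
  (forall i j, e i j -> sigma i j = -1) ->
  (forall p : R, 1 < p ->
     Sp mu p (f p) /\
     is_p_eigenfunction e sigma w mu kappa p (f p)
       (lambda_top e sigma w mu kappa p)) ->
  exists g : 'I_n -> R,
    (forall i, (`|f p i| `^ (p / 2)) @[p --> +oo] --> g i) /\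
    exists lam : R,
      is_largest_eigenvalue (adj_mu e (fun i j => - sigma i j) w mu) lam /\
      is_mx_eigenpair (adj_mu e (fun i j => - sigma i j) w mu) lam g.
Proof.
move=> graph e_conn sigmaN1 f_eig.
have mu_gt0 : forall i, 0 < mu i := graph.2.2.2.
(* On an empty vertex set the normalizing sum would be 0, not 1. *)
have n_gt0 : (0 < n)%N.
  have [f1 _] := f_eig 2 (ltr1n _ 2); rewrite lt0n; apply/eqP => n0.
  by move: f1; rewrite /Sp/= big1 => [/eqP|[i i_lt] _];
    [rewrite eq_sym oner_eq0|exfalso; move: i_lt; rewrite n0].
pose W := adj e w.
have W_conn i j : connect [rel i j | 0 < W i j] i j.
  rewrite (@eq_connect _ _ e)// => k l /=; exact: adj_gt0 graph k l.
have [lam [h [h_gt0 h1 hE]]] := 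
  perron_vector mu_gt0 (adj_sym graph) (adj_ge0 graph) W_conn n_gt0.
pose M := adj_mu e (fun i j => - sigma i j) w mu.
have ME g i : \sum_j M i j * g j = (\sum_j W i j * g j) / mu i.
  rewrite mulr_suml; apply: eq_bigr => j _; rewrite /M /adj_mu /W /adj.
  by case: ifP => [/sigmaN1 ->|_]; rewrite ?mul0r// opprK mul1r mulrAC.
have h_eig : is_mx_eigenpair M lam h.
  split; first by exists (Ordinal n_gt0); rewrite gt_eqF.
  by move=> i; rewrite ME hE mulrAC mulfK// gt_eqF.
exists h; split; last first.
  exists lam; split => //; split; first by exists h.
  (* Pairing the equation for g with g in l^2(mu) gives a * wdot = bilin <= lam * wdot. *)
  move=> a g [[i gi] gE].
  have gg : 0 < wdot mu g g.
    rewrite lt0r wdot_ge0// andbT; apply: contra_neq gi.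
    by move=> /(wdot_eq0 mu_gt0)->.
  rewrite -(ler_pM2r gg); apply: le_trans (bilin_le_wdot graph h_gt0 hE g).
  rewrite /wdot mulr_sumr; apply: ler_sum => k _.
  have -> : \sum_j W k j * g k * g j = g k * (\sum_j W k j * g j).
    by rewrite mulr_sumr; apply: eq_bigr => j _; ring.
  have := gE k; rewrite ME => /(canRL (mulfVK _)) ->.
    by rewrite le_eqVlt; apply/predU1P; left; ring.
  by rewrite gt_eqF.
(* The limit is the Perron vector h, so the claim becomes u -> 1 at every vertex. *)
pose u p i := `|f p i| `^ (p / 2) / h i.
pose D := 16 * (edge_bound e w mu + potential_bound mu kappa).
have edge_near i j : e i j -> forall eps, 0 < eps ->
    \forall p \near +oo, `|u p i - u p j| <= eps.
  move=> eij eps eps0.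
  have Wij : 0 < W i j by rewrite /W (adj_gt0 graph).
  have c_gt0 : 0 < W i j * h i * h j by rewrite !mulr_gt0.
  near=> p.
  have p1 : 1 < p by near: p; apply: nbhs_pinfty_gt; exact: num_real.
  have p0 : 0 < p by lra.
  have [f1 fE] := f_eig p p1.
  have gap := edge_gap_le graph sigmaN1 h_gt0 h1 hE i j p0 f1 fE.
  (* From this threshold on, the edge gap D / p is at most W_ij h_i h_j eps^2. *)
  have pD : D / (W i j * h i * h j * eps ^+ 2) <= p.
    by near: p; apply: nbhs_pinfty_ge; exact: num_real.
  move: pD; rewrite ler_pdivrMr ?mulr_gt0 ?exprn_gt0// => pD.
  have : (u p i - u p j) ^+ 2 <= eps ^+ 2.
    rewrite -(ler_pM2l c_gt0); apply: (le_trans gap).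
    by rewrite ler_pdivrMr// [leRHS]mulrC.
  by rewrite -[X in X <= _](real_normK (num_real _)) ler_pXn2r// nnegrE ltW.
have all_near := connect_near_dist edge_near.
have u_cvg i eps : 0 < eps -> \forall p \near +oo, `|u p i - 1| <= eps.
  move=> eps0.
  have near_i : \forall p \near +oo, forall j, `|u p i - u p j| <= eps.
    by apply: filter_forall => j; exact: all_near (e_conn i j) _ eps0.
  near=> p.
  have p1 : 1 < p by near: p; apply: nbhs_pinfty_gt; exact: num_real.
  have [f1 _] := f_eig p p1.
  apply: (wdot_eq1_dist mu_gt0 h1).
  - by move=> j; rewrite divr_ge0 ?powR_ge0 ?ltW.
  - rewrite -[RHS](wdot_powR_half f1); congr wdot;
      by apply/funext => j; rewrite mulrC /u divfK// gt_eqF.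
  - by near: p.
move=> i; have -> : (fun p => `|f p i| `^ (p / 2)) = (fun p => h i * u p i).
  by apply/funext => p; rewrite [RHS]mulrC /u divfK// gt_eqF.
rewrite -[X in _ --> X]mulr1; apply: cvgM; first exact: cvg_cst.
by apply/cvgrPdist_le => eps eps0; have := u_cvg i eps eps0;
  apply: filterS => p; rewrite distrC.
Unshelve. all: by end_near. Qed.
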